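(* Let $n\ge 3$ be an integer. If $n\equiv 0 \pmod 4$ or $n\equiv 3\pmod 4$, then there exists a strippable $IH_6(n;3)$.
   Context: Definition of a square integer relative Heffter array $IH_t(n;k)$: let $n,k,t$ be positive integers such that $t$ divides $2nk$, put $v=2nk+t$, and let $J$ be the unique subgroup of $\mathbb{Z}_v$ of order $t$. An $IH_t(n;k)$ is an $n\times n$ partially filled array (cells may be empty) with entries in $\mathbb{Z}_v$, each entry being written as its representative of least absolute value (an integer of absolute value at most $v/2$), such that: (1) each row and each column contains exactly $k$ filled cells; (2) for every $x\in\mathbb{Z}_v\setminus J$, either $x$ or $-x$ appears in the array; (3) the entries in every row and every column, regarded as integers, sum to $0$ in $\mathbb{Z}$. (By counting, exactly one of $x,-x$ appears, exactly once, for each $x\in\mathbb{Z}_v\setminus J$, and no element of $J$ appears.) A primary transversal of such an array is a set of $n$ filled cells, one in each row and one in each column, such that the set of absolute values of their entries is $\{1,\dots,n\}$. A partially filled array is shiftable if each row and each column contains the same number of positive entries as negative entries. The array is strippable if it has a primary transversal whose removal (emptying those cells) leaves a shiftable array. *)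

(* Defs.v *)
From mathcomp Require Import all_boot all_order all_algebra all_fingroup.

Set Implicit Arguments.
Unset Strict Implicit.
Unset Printing Implicit Defensive.

Import Order.TTheory GRing.Theory Num.Theory.
Local Open Scope ring_scope.

(* None is an empty cell; Some a is a cell filled with the residue class of a
   in Z_v, where a is the chosen integer representative. *)
Definition pfarray (n : nat) := 'M[option int]_n.

Definition filled n (A : pfarray n) (i j : 'I_n) : bool := isSome (A i j).

Definition heffter_modulus (n k t : nat) : nat := (2 * n * k + t)%N.

(* A is an IH_t(n;k).  Since heffter_modulus n k t > 1 under the positivity
   hypotheses, 'Z_v is really Z/vZ; being cyclic it has a single subgroup of
   order t, so the J of IH_support is uniquely determined.  For even v the
   element v/2 has two representatives within IH_range, but it lies in J and
   so, by counting, never occurs. *)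
Record is_IH (t n k : nat) (A : pfarray n) : Prop := IsIH {
  IH_n_gt0 : (0 < n)%N;
  IH_k_gt0 : (0 < k)%N;
  IH_t_gt0 : (0 < t)%N;
  IH_dvd : (t %| 2 * n * k)%N;
  IH_range : forall (i j : 'I_n) (a : int),
    A i j = Some a -> (2 * `|a| <= heffter_modulus n k t)%N;
  IH_rows_card : forall i : 'I_n, #|[set j | filled A i j]| = k;
  IH_cols_card : forall j : 'I_n, #|[set i | filled A i j]| = k;
  IH_support : exists2 J : {group 'Z_(heffter_modulus n k t)}, #|J| = t &
    forall x : 'Z_(heffter_modulus n k t), x \notin J ->
      exists (i j : 'I_n) (a : int),
        A i j = Some a /\ (a%:~R = x \/ a%:~R = - x);
  IH_rows_sum : forall i : 'I_n, \sum_j odflt 0 (A i j) = 0;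
  IH_cols_sum : forall j : 'I_n, \sum_i odflt 0 (A i j) = 0
}.

Definition primary_transversal n (A : pfarray n) (T : {set 'I_n * 'I_n}) :
    Prop :=
  [/\ #|T| = n,
      forall c, c \in T -> filled A c.1 c.2,
      forall i : 'I_n, #|[set c in T | c.1 == i]| = 1%N,
      forall j : 'I_n, #|[set c in T | c.2 == j]| = 1%N &
      forall m : nat, (1 <= m <= n)%N <->
        exists2 c, c \in T & exists2 a : int, A c.1 c.2 = Some a & `|a|%N = m].

Definition pos_cell n (A : pfarray n) (i j : 'I_n) : bool :=
  if A i j is Some a then 0 < a else false.

Definition neg_cell n (A : pfarray n) (i j : 'I_n) : bool :=
  if A i j is Some a then a < 0 else false.

Definition shiftable n (A : pfarray n) : Prop :=
  (forall i : 'I_n, #|[set j | pos_cell A i j]| = #|[set j | neg_cell A i j]|)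
  /\
  (forall j : 'I_n, #|[set i | pos_cell A i j]| = #|[set i | neg_cell A i j]|).

Definition remove_cells n (A : pfarray n) (T : {set 'I_n * 'I_n}) : pfarray n :=
  \matrix_(i, j) if (i, j) \in T then None else A i j.

Definition strippable n (A : pfarray n) : Prop :=
  exists2 T, primary_transversal A T & shiftable (remove_cells A T).

(* Main.v *)
Require Import Defs.
From mathcomp Require Import all_boot all_order all_algebra all_fingroup.
From mathcomp Require Import cyclic zify.

Set Implicit Arguments.
Unset Strict Implicit.
Unset Printing Implicit Defensive.

Import Order.TTheory GRing.Theory Num.Theory.

(** With v = 6n + 6 the subgroup J consists of the multiples of n + 1, so the
    absolute values that have to occur are 1, ..., n (the small entries) and
    n + 1 + k for 1 <= k <= 2n + 1, k <> n + 1 (the large entries).  The small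
    entries go on the diagonal, which becomes the primary transversal, and
    every row and column receives two large entries of opposite signs, which
    makes the rest shiftable.  A line then sums to zero exactly when its small
    entry is, up to sign, the difference of its two large ones.

    The rows thus ask for a partition of {1, ..., 2n + 1} minus n + 1 into
    pairs with differences 1, ..., n, that is, a Rosa (split Skolem) sequence;
    these exist precisely for n congruent to 0 or 3 modulo 4
    ([rosa_exists]).  The columns need a second such partition.  The mirror
    map k |-> 2n + 2 - k gives one for free: it fixes the hole n + 1 and
    preserves the difference of a pair.  So the large
    entry of k is put in the row of the pair that contains k and in the column
    of the pair that contains the mirror image of k.  The three cells of a line
    are distinct as soon as no pair of the sequence is its own mirror image,
    which is part of [rosa].

    It remains to choose signs so that both the pairs and their mirror images
    carry opposite signs.  It suffices that the sign changes along each pair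
    and under the mirror map.  These are two perfect matchings of the same
    set, their union is a disjoint union of even cycles, and hence such a sign
    exists ([involutions_two_coloring]).  Finally the diagonal entry needs the
    same sign for the row as for the column: the mirror map exchanges the ends
    of a pair and flips the signs, so both lines ask for the same sign
    ([row_entries_sum], [col_entries_sum]). *)

(** * Rosa sequences without self-mirror pairs *)

(** The pair of difference d is {a d, a d + d}.  The 2n ends are distinct
    elements of {1, ..., 2n + 1} other than the hole n + 1, so they are all of
    these.  The last clause on a single d excludes the pairs that are symmetric
    about n + 1. *)
Definition rosa (n : nat) (a : nat -> nat) : Prop :=
  [/\ forall d, 0 < d <= n ->
        [/\ 0 < a d, a d + d <= 2 * n + 1, a d != n.+1, a d + d != n.+1 &
            a d + (a d + d) != 2 * n + 2],
      forall d e, 0 < d <= n -> 0 < e <= n -> a d <> a e + e &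
      forall d e, 0 < d <= n -> 0 < e <= n -> d != e ->
        a d <> a e /\ a d + d <> a e + e].

(** Order 4m.  The even differences below 4m form one nested family on the right
    of the hole, and the odd differences other than 1 and 2m + 1 form two nested
    families on its left.
    The sum of a pair is constant on a nested family, so the left end is half of
    a constant minus d.  The remaining pairs
    {2m+2, 6m+2}, {2m+1, 4m+2} and {m, m+1} use the leftover positions. *)
Definition rosa_mod0 (m d : nat) : nat :=
  if d == 4 * m then 2 * m + 2
  else if ~~ odd d then 6 * m + 2 - d./2
  else if d == 1 then m
  else if d == 2 * m + 1 then 2 * m + 1
  else if d < 2 * m + 1 then (4 * m + 3 - d)./2
  else (4 * m + 1 - d)./2.

(** Order 4m - 1.  This is the classical Skolem sequence of order 4m from which
    the pair {4m, 8m} of the largest difference is deleted: the hole is then at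
    4m, in the middle of the remaining positions.  For m = 1 several branches
    have the same condition, and their order matters. *)
Definition rosa_mod3 (m d : nat) : nat :=
  if d == 4 * m - 1 then 2 * m + 1
  else if ~~ odd d then 6 * m - d./2
  else if d == 1 then m
  else if d == 2 * m + 1 then m - 1
  else if d == 2 * m - 1 then 2 * m
  else if d < 2 * m - 1 then (4 * m + 1 - d)./2
  else (4 * m - 1 - d)./2.

Lemma rosa_mod0_correct (m : nat) : 0 < m -> rosa (4 * m) (rosa_mod0 m).
Proof.
move=> m0; split.
- by move=> d; rewrite /rosa_mod0; do ! case: ifP => ?; split; lia.
- by move=> d e; rewrite /rosa_mod0; do ! case: ifP => ?; lia.
- by move=> d e; rewrite /rosa_mod0; do ! case: ifP => ?; lia.
Qed.

Lemma rosa_mod3_correct (m : nat) : 0 < m -> rosa (4 * m - 1) (rosa_mod3 m).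
Proof.
move=> m0; split.
- by move=> d; rewrite /rosa_mod3; do ! case: ifP => ?; split; lia.
- by move=> d e; rewrite /rosa_mod3; do ! case: ifP => ?; lia.
- by move=> d e; rewrite /rosa_mod3; do ! case: ifP => ?; lia.
Qed.

Lemma rosa_exists (n : nat) : 3 <= n -> n = 0 %[mod 4] \/ n = 3 %[mod 4] ->
  exists a, rosa n a.
Proof.
move=> n3 [] nmod.
  have [m m0 ->] : exists2 m, 0 < m & n = 4 * m by exists (n %/ 4); lia.
  by exists (rosa_mod0 m); apply: rosa_mod0_correct.
have [m m0 ->] : exists2 m, 0 < m & n = 4 * m - 1 by exists (n %/ 4).+1; lia.
by exists (rosa_mod3 m); apply: rosa_mod3_correct.
Qed.

(** * A common two-colouring of two perfect matchings *)

(** The union of the matchings x -- f x and x -- g x consists of even cycles.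
    Going around a cycle by steps of two is iterating h = g o f, so each cycle
    splits into the h-orbits of x and of f x.  These are distinct because a
    coincidence would, by shortening the path from both ends, produce a fixed
    point of f or of g.  The colour says which of the two orbits contains x, as
    decided by an arbitrary order on orbit representatives. *)
Lemma involutions_two_coloring (T : finType) (f g : T -> T) :
    involutive f -> involutive g ->
    (forall x, f x != x) -> (forall x, g x != x) ->
  exists c : T -> bool, forall x, c (f x) = ~~ c x /\ c (g x) = ~~ c x.
Proof.
move=> fK gK f_fpf g_fpf; pose h := g \o f.
have h_inj : injective h by apply: inj_comp; apply: inv_inj.
have h_root x : froot h (h x) = froot h x.
  apply/eqP; rewrite (root_connect (fconnect_sym h_inj)).
  by rewrite fconnect_sym // fconnect1.
(* Shortening a path from x to f x at both ends gives one from h x to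
   f (h x). *)
have iter_h_neq k : forall x, iter k h x != f x.
  elim/ltn_ind: k => -[|[|k]] IHk x /=; rewrite ?[_ == f x]eq_sym //.
  - by rewrite eq_sym g_fpf.
  - apply: contraNneq (IHk k (leqW (leqnn _)) (h x)) => fx_eq.
    by rewrite -iterSr -(inj_eq h_inj) /= -fx_eq /h /= fK gK.
have root_neq x : froot h x != froot h (f x).
  rewrite (root_connect (fconnect_sym h_inj)).
  apply: contraT => /negPn /iter_findex /eqP.
  by rewrite (negPf (iter_h_neq _ x)).
exists (fun x => (enum_rank (froot h x) < enum_rank (froot h (f x)))%N) => x.
have rank_neq : enum_rank (froot h x) != enum_rank (froot h (f x)) :> nat.
  by rewrite (inj_eq val_inj) (inj_eq enum_rank_inj).
have root_g : froot h (g x) = froot h (f x).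
  by rewrite -[RHS]h_root; congr (froot _ _); rewrite /h /= fK.
have root_fg : froot h (f (g x)) = froot h x.
  by rewrite -[LHS]h_root; congr (froot _ _); rewrite /h /= fK gK.
by rewrite fK root_g root_fg; split; lia.
Qed.

(** * Mirror-compatible placement *)

(** A Rosa sequence indexed by the ends of its pairs: (i, false) and (i, true)
    are the left and right ends of the pair of difference i + 1, p gives the
    positions, r is the mirror map read on the ends, and c is true on the ends
    whose large entry is negative. *)
Record placement (n : nat) (p : 'I_n * bool -> nat)
    (r : 'I_n * bool -> 'I_n * bool) (c : 'I_n * bool -> bool) : Prop :=
  Placement {
    place_pair : forall i, p (i, true) = p (i, false) + i.+1;
    place_inj : injective p;
    place_bound : forall x, 0 < p x <= 2 * n + 1;
    place_onto : forall k, 0 < k <= 2 * n + 1 -> k != n.+1 -> exists x, p x = k;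
    place_mirror : forall x, p x + p (r x) = 2 * n + 2;
    place_moved : forall x, (r x).1 != x.1;
    place_color_pair : forall i, c (i, true) = ~~ c (i, false);
    place_color_mirror : forall x, c (r x) = ~~ c x
  }.

(** Injectivity of the 2n positions and the size of the range force every
    position other than the hole to be taken, so that the mirror map can be
    transported to the ends of pairs.  There it moves every end to another
    pair: an end is not its own mirror image because only n + 1 is, and the two
    ends of a pair are not mirror images of each other by the choice of the
    sequence. *)
Lemma rosa_placement (n : nat) (a : nat -> nat) :
  rosa n a -> exists p r c, @placement n p r c.
Proof.
case=> a_range a_sep a_inj.
have dP (i : 'I_n) : 0 < i.+1 <= n by rewrite ltn_ord.
pose p (x : 'I_n * bool) := a x.1.+1 + x.2 * x.1.+1.
have p_bound x : 0 < p x <= 2 * n + 1 /\ p x != n.+1.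
  case: x => i b; rewrite /p /=; case: (a_range _ (dP i)) => *.
  by case: b; lia.
have p_inj : injective p.
  move=> [i b] [j b']; rewrite /p /=.
  have [-> | ij] := eqVneq i j.
    by case: b b' => [] [] //=; lia.
  have neq_ij : i.+1 != j.+1 by [].
  have [??] := a_inj _ _ (dP i) (dP j) neq_ij.
  have ? := a_sep _ _ (dP i) (dP j); have ? := a_sep _ _ (dP j) (dP i).
  by case: b b' => [] [] /=; lia.
have p_onto k : 0 < k <= 2 * n + 1 -> k != n.+1 -> exists x, p x = k.
  have lt_p x : p x < 2 * n + 2 by case: (p_bound x); lia.
  pose q x := Ordinal (lt_p x).
  have q_inj : injective q by move=> x y /(congr1 val) /p_inj.
  have lt0 : 0 < 2 * n + 2 by lia.
  move=> k_bound k_neq.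
  have n0 : 0 < n by lia.
  have ltm : n.+1 < 2 * n + 2 by lia.
  have ltk : k < 2 * n + 2 by lia.
  pose B := ~: [set Ordinal lt0; Ordinal ltm].
  have cardB : #|B| = 2 * n.
    have := cardsC [set Ordinal lt0; Ordinal ltm].
    by rewrite cards2 card_ord -/B /=; lia.
  have sub : q @: setT \subset B.
    apply/subsetP=> _ /imsetP[x _ ->]; rewrite !inE -!val_eqE /=.
    by case: (p_bound x) => /andP[]; lia.
  have /eqP qB : q @: setT == B.
    rewrite eqEcard sub cardB card_imset //.
    by rewrite cardsT card_prod card_ord card_bool; lia.
  have : Ordinal ltk \in B by rewrite !inE -!val_eqE /=; lia.
  by rewrite -qB => /imsetP[x _ /(congr1 val) /= ->]; exists x.
have r_ex x : exists y, p x + p y = 2 * n + 2.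
  case: (p_bound x) => xb xn.
  have [||y y_eq] := p_onto (2 * n + 2 - p x); [lia|lia|].
  by exists y; lia.
have {r_ex} [r r_mirror] := fin_all_exists r_ex.
have r_inv : involutive r.
  by move=> x; apply: p_inj; have := r_mirror x; have := r_mirror (r x); lia.
have r_moved x : (r x).1 != x.1.
  apply/eqP; have [_] := p_bound x; have := r_mirror x.
  case: x (r x) => i b [j b'] /= + + ij; rewrite ij /p /=.
  have [_ _ _ _] := a_range _ (dP i).
  by case: b b' => [] [] /=; lia.
pose mate (x : 'I_n * bool) := (x.1, ~~ x.2).
have [||||c cP] := @involutions_two_coloring _ mate r.
- by case=> i b; rewrite /mate /= negbK.
- exact: r_inv.
- by case=> i b; rewrite /mate xpair_eqE /= eqxx; case: b.
- by move=> x; apply: contraNneq (r_moved x) => ->.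
exists p, r, c; split => //.
- by move=> i; rewrite /p /=; lia.
- by move=> x; case: (p_bound x).
- by move=> i; exact: (cP (i, false)).1.
- by move=> x; exact: (cP x).2.
Qed.

(** * Lines with at most three filled cells *)

Local Open Scope ring_scope.

(** Stated for an arbitrary F so that it serves both for the sum of a line and,
    with F an indicator, for counting cells of a given kind.  The contents are
    options so that it also applies once the cell k0 has been emptied. *)
Lemma sum_three_cells (V : nmodType) (n : nat) (f : 'I_n -> option int)
    (F : option int -> V) (k0 k1 k2 : 'I_n) (o0 o1 o2 : option int) :
    F None = 0 -> k1 != k0 -> k2 != k0 -> k1 != k2 ->
    (forall j, f j = if j == k0 then o0 else if j == k1 then o1
                     else if j == k2 then o2 else None) ->
  \sum_j F (f j) = F o0 + F o1 + F o2.
Proof.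
move=> F0 k10 k20 k12 fE.
rewrite (bigD1 k0) //= (bigD1 k1) //= (bigD1 k2) /=; last first.
  by rewrite k20 eq_sym k12.
rewrite big1 => [|j /andP[/andP[j0 j1] j2]]; last first.
  by rewrite fE (negPf j0) (negPf j1) (negPf j2).
rewrite !fE !eqxx (negPf k10) (negPf k20) [k2 == k1]eq_sym (negPf k12).
by rewrite addr0 addrA.
Qed.

Lemma card_three_cells (n : nat) (f : 'I_n -> option int)
    (P : pred (option int)) (k0 k1 k2 : 'I_n) (o0 o1 o2 : option int) :
    ~~ P None -> k1 != k0 -> k2 != k0 -> k1 != k2 ->
    (forall j, f j = if j == k0 then o0 else if j == k1 then o1
                     else if j == k2 then o2 else None) ->
  #|[set j | P (f j)]| = (P o0 + P o1 + P o2)%N.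
Proof.
move=> P0 k10 k20 k12 fE.
rewrite -sum1_card big_mkcond /=.
rewrite (eq_bigr (fun j => P (f j) : nat)) => [|j _]; last first.
  by rewrite inE; case: (P (f j)).
apply: (@sum_three_cells nat n f (fun o => P o : nat) k0 k1 k2) => //.
by rewrite (negPf P0).
Qed.

(** * Subgroups of the integers modulo v *)

(** The subgroup is generated by the class of s. *)
Lemma Zp_subgroup (v s t : nat) : (1 < v)%N -> v = (s * t)%N ->
  exists2 J : {group 'Z_v}, #|J| = t & forall x : 'Z_v, (s %| x)%N -> x \in J.
Proof.
move=> v1 vE; have vT := Zp_cast v1.
exists <[(Zp1 : 'Z_v) ^+ s]>%G => [|x /dvdnP[k xE]].
  rewrite -[LHS]/(#[(Zp1 : 'Z_v) ^+ s]%g) orderXdiv order_Zp1 vT vE.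
    by rewrite mulKn //; lia.
  exact: dvdn_mulr.
by rewrite -[x]Zp1_expgz xE mulnC expgM mem_cycle.
Qed.

(** * The array of a placement *)

Definition large_entry n p (c : 'I_n * bool -> bool) x : int :=
  if c x then - (n.+1 + p x)%N%:Z else (n.+1 + p x)%N%:Z.

Definition small_entry n (c : 'I_n * bool -> bool) i : int :=
  if c (i, false) then - i.+1%:Z else i.+1%:Z.

Definition placement_array n p (r : 'I_n * bool -> 'I_n * bool)
    (c : 'I_n * bool -> bool) : pfarray n :=
  \matrix_(i, j)
    if j == i then Some (small_entry c i)
    else if j == (r (i, false)).1 then Some (large_entry p c (i, false))
    else if j == (r (i, true)).1 then Some (large_entry p c (i, true))
    else None.

Section PlacementArray.

Variables (n : nat) (p : 'I_n * bool -> nat).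
Variables (r : 'I_n * bool -> 'I_n * bool) (c : 'I_n * bool -> bool).
Hypothesis pl : placement p r c.

Let A := placement_array p r c.

Lemma place_mirrorK : involutive r.
Proof.
move=> x; apply: (place_inj pl).
by have := place_mirror pl x; have := place_mirror pl (r x); lia.
Qed.

(** If the ends of a pair were mirrored into one pair, the latter would have the
    same difference, so the pair would be its own mirror image. *)
Lemma place_columns_neq i : (r (i, false)).1 != (r (i, true)).1.
Proof.
apply/eqP.
have := place_mirror pl (i, false); have := place_mirror pl (i, true).
have := place_moved pl (i, false); rewrite (place_pair pl) /=.
have := place_mirrorK (i, true); have := place_mirrorK (i, false).
case: (r (i, false)) (r (i, true)) => [j b] [k b'] /= rF rT ji + + jk.
subst k; have := place_pair pl j.
have ij : j != i :> nat by [].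
case: b b' rF rT => [] [] rF rT; try (by rewrite rF in rT; case: rT); lia.
Qed.

Lemma placement_array_large x : A x.1 (r x).1 = Some (large_entry p c x).
Proof.
have := place_moved pl x; case: x => i b /= moved.
rewrite mxE (negPf moved); case: b moved => moved; last by rewrite eqxx.
by rewrite eq_sym (negPf (place_columns_neq i)) eqxx.
Qed.

Lemma placement_array_small i : A i i = Some (small_entry c i).
Proof. by rewrite mxE eqxx. Qed.

Lemma placement_array_row i j : A i j =
    if j == i then Some (small_entry c i)
    else if j == (r (i, false)).1 then Some (large_entry p c (i, false))
    else if j == (r (i, true)).1 then Some (large_entry p c (i, true))
    else None.
Proof. by rewrite mxE. Qed.

(** Columns have the same shape as rows because the mirror map is an involution:
    the ends mirrored into the pair j are the mirror images of the ends of j. *)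
Lemma placement_array_col j i : A i j =
    if i == j then Some (small_entry c j)
    else if i == (r (j, false)).1 then Some (large_entry p c (r (j, false)))
    else if i == (r (j, true)).1 then Some (large_entry p c (r (j, true)))
    else None.
Proof.
have [-> | ij] := eqVneq i j; first exact: placement_array_small.
have col b : A (r (j, b)).1 j = Some (large_entry p c (r (j, b))).
  by have := placement_array_large (r (j, b)); rewrite place_mirrorK.
have [-> // | iF] := eqVneq i (r (j, false)).1.
have [-> // | iT] := eqVneq i (r (j, true)).1.
rewrite placement_array_row eq_sym (negPf ij).
have row b : j != (r (i, b)).1.
  apply/eqP=> jr; have := place_mirrorK (i, b).
  case: (r (i, b)) jr => _ b' /= <- rj.
  by case: b' rj iF iT => ->; rewrite eqxx.
by rewrite !(negPf (row _)).
Qed.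

Lemma placement_array_inv i j a : A i j = Some a ->
  a = small_entry c i \/ exists x, a = large_entry p c x.
Proof.
rewrite placement_array_row; do ! case: ifP => // _; case=> <-; first by left.
  by right; exists (i, false).
by right; exists (i, true).
Qed.

Lemma small_entry_abs i : `|small_entry c i|%N = i.+1.
Proof. by rewrite /small_entry; case: ifP; lia. Qed.

Lemma large_entry_abs x : `|large_entry p c x|%N = (n.+1 + p x)%N.
Proof. by rewrite /large_entry; case: ifP; lia. Qed.

Lemma row_entries_sum i :
  small_entry c i + large_entry p c (i, false) + large_entry p c (i, true) = 0.
Proof.
rewrite /small_entry /large_entry (place_color_pair pl) (place_pair pl).
by case: (c (i, false)) => /=; lia.
Qed.

(** The mirror map reverses the order of positions and flips the colours; these
    two sign changes cancel, so column j needs the same small entry as row j. *)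
Lemma col_entries_sum j :
  small_entry c j + large_entry p c (r (j, false))
    + large_entry p c (r (j, true)) = 0.
Proof.
rewrite /small_entry /large_entry.
rewrite !(place_color_mirror pl) (place_color_pair pl).
have := place_mirror pl (j, false); have := place_mirror pl (j, true).
by rewrite (place_pair pl); case: (c (j, false)) => /=; lia.
Qed.

Lemma placement_array_attains m : (0 < m <= 3 * n + 2)%N ->
    m != n.+1 -> m != (2 * n.+1)%N ->
  exists i j a, A i j = Some a /\ `|a|%N = m.
Proof.
move=> m_bound m_neq1 m_neq2; have [m_le | m_gt] := leqP m n.
  have lt_m : (m.-1 < n)%N by lia.
  pose i := Ordinal lt_m; exists i, i, (small_entry c i).
  by rewrite placement_array_small small_entry_abs /=; split=> //; lia.
have [||x px] := place_onto pl (k := (m - n.+1)%N); [lia|lia|].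
exists x.1, (r x).1, (large_entry p c x).
by rewrite placement_array_large large_entry_abs; split=> //; lia.
Qed.

(** A residue that is not a multiple of n + 1 is, up to sign, one of
    1, ..., 3n + 2 other than n + 1 and 2n + 2. *)
Lemma placement_array_support : (0 < n)%N ->
  exists2 J : {group 'Z_(heffter_modulus n 3 6)}, #|J| = 6 &
    forall x : 'Z_(heffter_modulus n 3 6), x \notin J ->
      exists (i j : 'I_n) (a : int),
        A i j = Some a /\ (a%:~R = x \/ a%:~R = - x).
Proof.
move=> n0; have v1 : (1 < heffter_modulus n 3 6)%N.
  by rewrite /heffter_modulus; lia.
have [|J cardJ JP] := @Zp_subgroup _ n.+1 6 v1.
  by rewrite /heffter_modulus; lia.
exists J => // x xJ.
have x_mult k : (x : nat) <> (k * n.+1)%N.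
  by move=> xE; move: xJ; rewrite JP // xE dvdn_mull.
have x_lt : (x < heffter_modulus n 3 6)%N.
  by rewrite -[X in (_ < X)%N](Zp_cast v1).
pose m : nat :=
  if (x <= 3 * n + 2)%N then (x : nat) else (heffter_modulus n 3 6 - x)%N.
have mx : m%:R = x \/ m%:R = - x.
  rewrite /m; case: ifP => _; [left | right]; rewrite ?natr_Zp //.
  by rewrite natrB 1?ltnW // pchar_Zp // natr_Zp sub0r.
(* m = k (n + 1) means that x is k (n + 1) or (6 - k) (n + 1).  The first goal
   also excludes x = 3 (n + 1), for which m exceeds 3n + 2. *)
have [|||i [j [a [aE am]]]] := @placement_array_attains m.
- have := x_mult 0; have := x_mult 3.
  by rewrite /m; case: ifP; move: x_lt; rewrite /heffter_modulus; lia.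
- have := x_mult 1; have := x_mult 5.
  by rewrite /m; case: ifP; move: x_lt; rewrite /heffter_modulus; lia.
- have := x_mult 2; have := x_mult 4.
  by rewrite /m; case: ifP; move: x_lt; rewrite /heffter_modulus; lia.
exists i, j, a; split=> //.
have [a_pos | a_neg] : a = m%:Z \/ a = - m%:Z by lia.
  by rewrite a_pos.
rewrite a_neg mulrNz -pmulrn.
by case: mx => /= ->; [right | left; rewrite opprK].
Qed.

Lemma placement_array_IH : (0 < n)%N -> is_IH 6 3 A.
Proof.
move=> n0; split=> //.
- by rewrite /dvdn; lia.
- move=> i j a /placement_array_inv aE; rewrite /heffter_modulus.
  case: aE => [->|[x ->]].
    by rewrite small_entry_abs; have := ltn_ord i; lia.
  by rewrite large_entry_abs; have := place_bound pl x; lia.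
- move=> i.
  rewrite (card_three_cells (P := isSome) _ _ _ _ (placement_array_row i)) //.
  + exact: place_moved pl (i, false).
  + exact: place_moved pl (i, true).
  + exact: place_columns_neq.
- move=> j.
  rewrite (card_three_cells (P := isSome) _ _ _ _ (placement_array_col j)) //.
  + exact: place_moved pl (j, false).
  + exact: place_moved pl (j, true).
  + exact: place_columns_neq.
- exact: placement_array_support.
- move=> i.
  rewrite (sum_three_cells (F := odflt 0) _ _ _ _ (placement_array_row i)) //.
  + exact: row_entries_sum.
  + exact: place_moved pl (i, false).
  + exact: place_moved pl (i, true).
  + exact: place_columns_neq.
- move=> j.
  rewrite (sum_three_cells (F := odflt 0) _ _ _ _ (placement_array_col j)) //.
  + exact: col_entries_sum.
  + exact: place_moved pl (j, false).
  + exact: place_moved pl (j, true).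
  + exact: place_columns_neq.
Qed.

Let diagonal : {set 'I_n * 'I_n} := [set (i, i) | i : 'I_n].

Lemma mem_diagonal i j : ((i, j) \in diagonal) = (i == j).
Proof.
by apply/imsetP/eqP => [[k _ [-> ->]] | ->] //; exists j.
Qed.

Lemma diagonal_primary : primary_transversal A diagonal.
Proof.
split.
- by rewrite card_imset ?card_ord // => i j [].
- by move=> _ /imsetP[i _ ->]; rewrite /filled placement_array_small.
- move=> i; suff -> : [set e in diagonal | e.1 == i] = [set (i, i)].
    by rewrite cards1.
  apply/setP=> -[k l]; rewrite !inE mem_diagonal xpair_eqE /=.
  by case: (eqVneq k i) => [->|_]; rewrite ?andbT ?andbF // eq_sym.
- move=> j; suff -> : [set e in diagonal | e.2 == j] = [set (j, j)].
    by rewrite cards1.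
  apply/setP=> -[k l]; rewrite !inE mem_diagonal xpair_eqE /=.
  by case: (eqVneq l j) => [->|_]; rewrite ?andbT ?andbF.
- move=> m; split=> [m_bound | [_ /imsetP[i _ ->]] [a]].
    have lt_m : (m.-1 < n)%N by lia.
    pose i := Ordinal lt_m; exists (i, i); first by rewrite mem_diagonal.
    exists (small_entry c i); first by rewrite placement_array_small.
    by rewrite small_entry_abs /=; lia.
  rewrite placement_array_small => -[<-] <-; rewrite small_entry_abs.
  by have := ltn_ord i; lia.
Qed.

Lemma removed_row i j : remove_cells A diagonal i j =
    if j == i then None
    else if j == (r (i, false)).1 then Some (large_entry p c (i, false))
    else if j == (r (i, true)).1 then Some (large_entry p c (i, true))
    else None.
Proof.
rewrite mxE mem_diagonal eq_sym placement_array_row.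
by case: (j == i).
Qed.

Lemma removed_col j i : remove_cells A diagonal i j =
    if i == j then None
    else if i == (r (j, false)).1 then Some (large_entry p c (r (j, false)))
    else if i == (r (j, true)).1 then Some (large_entry p c (r (j, true)))
    else None.
Proof. by rewrite mxE mem_diagonal placement_array_col; case: (i == j). Qed.

Lemma large_entry_gt0 x : (0 < large_entry p c x) = ~~ c x.
Proof. by rewrite /large_entry; case: (c x); lia. Qed.

Lemma large_entry_lt0 x : (large_entry p c x < 0) = c x.
Proof. by rewrite /large_entry; case: (c x); lia. Qed.

Lemma removed_shiftable : shiftable (remove_cells A diagonal).
Proof.
pose pos (o : option int) := if o is Some a then 0 < a else false.
pose neg (o : option int) := if o is Some a then a < 0 else false.
have moved := fun i b => place_moved pl (i, b).
split=> [i | j].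
  rewrite (card_three_cells (P := pos) isT (moved i false) (moved i true)
             (place_columns_neq i) (removed_row i)).
  rewrite (card_three_cells (P := neg) isT (moved i false) (moved i true)
             (place_columns_neq i) (removed_row i)).
  rewrite /pos /neg !large_entry_gt0 !large_entry_lt0 (place_color_pair pl).
  by case: (c _).
rewrite (card_three_cells (P := pos) isT (moved j false) (moved j true)
           (place_columns_neq j) (removed_col j)).
rewrite (card_three_cells (P := neg) isT (moved j false) (moved j true)
           (place_columns_neq j) (removed_col j)).
rewrite /pos /neg !large_entry_gt0 !large_entry_lt0.
by rewrite !(place_color_mirror pl) (place_color_pair pl); case: (c _).
Qed.

End PlacementArray.

Theorem theorem3p1 (n : nat) (hn : (3 <= n)%N)
    (hmod : n = 0 %[mod 4] \/ n = 3 %[mod 4]) :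
  exists A : pfarray n, is_IH 6 3 A /\ strippable A.
Proof.
have [a a_rosa] := rosa_exists hn hmod.
have [p [r [c pl]]] := rosa_placement a_rosa.
exists (placement_array p r c); split.
  by apply: placement_array_IH => //; apply: leq_trans hn.
by eexists; [apply: diagonal_primary | apply: removed_shiftable].
Qed.
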